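(* Let $A=(a_{ij})\in M_n(\mathbb{H})$ and let $\gamma\in[0,1]$. Then all the left eigenvalues of $A$ are located in the union of the $n$ balls $T_i(A):=\{z\in\mathbb{H}: |z-a_{ii}|\le r_i(A)^{\gamma}\,c_i(A)^{1-\gamma}\}$, $1\le i\le n$; that is, $$\Lambda_l(A)\subseteq T(A):=\bigcup_{i=1}^n T_i(A).$$
   Context: $\mathbb{H}$ is the skew field of real quaternions with modulus $|a_0+a_1\mathbf{i}+a_2\mathbf{j}+a_3\mathbf{k}|=\sqrt{a_0^2+a_1^2+a_2^2+a_3^2}$, and $M_n(\mathbb{H})$ is the set of $n\times n$ quaternionic matrices. A quaternion $\lambda$ is a left eigenvalue of $A\in M_n(\mathbb{H})$ if $Ax=\lambda x$ for some nonzero column vector $x\in\mathbb{H}^n$; $\Lambda_l(A)$ is the set of left eigenvalues. The deleted absolute row and column sums are $r_i(A):=\sum_{j\ne i}|a_{ij}|$ and $c_i(A):=\sum_{j\neq i}|a_{ji}|$. Convention: $0^0=1$. *)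

(* Defs.v *)
From HB Require Import structures.
From mathcomp Require Import all_boot all_order all_algebra.
From mathcomp Require Import ring lra.
From mathcomp Require Import all_classical all_reals.
From mathcomp Require Import exp.

Set Implicit Arguments.
Unset Strict Implicit.
Unset Printing Implicit Defensive.

Import Order.TTheory GRing.Theory Num.Theory.

Local Open Scope classical_set_scope.
Local Open Scope ring_scope.

(* [Quaternion a0 a1 a2 a3] is a0 + a1 i + a2 j + a3 k. *)
Record quaternion (R : Type) : Type := Quaternion { q0 : R; q1 : R; q2 : R; q3 : R }.

Section QuaternionChoice.
Variable R : Type.

Definition seq_of_quaternion (x : quaternion R) : seq R :=
  [:: q0 x; q1 x; q2 x; q3 x].

Definition quaternion_of_seq (s : seq R) : option (quaternion R) :=
  if s is [:: a; b; c; d] then Some (Quaternion a b c d) else None.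

Lemma seq_of_quaternionK : pcancel seq_of_quaternion quaternion_of_seq.
Proof. by case. Qed.

End QuaternionChoice.

HB.instance Definition _ (R : eqType) := Equality.copy (quaternion R)
  (pcan_type (@seq_of_quaternionK R)).
HB.instance Definition _ (R : choiceType) := Choice.copy (quaternion R)
  (pcan_type (@seq_of_quaternionK R)).

Section QuaternionRing.
Variable R : realFieldType.
Implicit Types x y z : quaternion R.

Definition quat0 : quaternion R := Quaternion 0 0 0 0.
Definition quat1 : quaternion R := Quaternion 1 0 0 0.
Definition opp_quat x := Quaternion (- q0 x) (- q1 x) (- q2 x) (- q3 x).
Definition add_quat x y :=
  Quaternion (q0 x + q0 y) (q1 x + q1 y) (q2 x + q2 y) (q3 x + q3 y).

(* i^2 = j^2 = k^2 = ijk = -1 *)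
Definition mul_quat x y := Quaternion
  (q0 x * q0 y - q1 x * q1 y - q2 x * q2 y - q3 x * q3 y)
  (q0 x * q1 y + q1 x * q0 y + q2 x * q3 y - q3 x * q2 y)
  (q0 x * q2 y - q1 x * q3 y + q2 x * q0 y + q3 x * q1 y)
  (q0 x * q3 y + q1 x * q2 y - q2 x * q1 y + q3 x * q0 y).

Lemma addquatA : associative add_quat.
Proof. by move=> x y z; rewrite /add_quat /= !addrA. Qed.

Lemma addquatC : commutative add_quat.
Proof. by move=> x y; congr Quaternion; rewrite addrC. Qed.

Lemma add0quat : left_id quat0 add_quat.
Proof. by case=> a b c d; rewrite /add_quat /= !add0r. Qed.

Lemma addNquat : left_inverse quat0 opp_quat add_quat.
Proof. by move=> x; rewrite /add_quat /= !addNr. Qed.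

HB.instance Definition _ :=
  GRing.isZmodule.Build (quaternion R) addquatA addquatC add0quat addNquat.

Lemma mulquatA : associative mul_quat.
Proof. by move=> x y z; congr Quaternion; rewrite /=; ring. Qed.

Lemma mul1quat : left_id quat1 mul_quat.
Proof. by case=> a b c d; congr Quaternion; rewrite /=; ring. Qed.

Lemma mulquat1 : right_id quat1 mul_quat.
Proof. by case=> a b c d; congr Quaternion; rewrite /=; ring. Qed.

Lemma mulquatDl : left_distributive mul_quat add_quat.
Proof. by move=> x y z; congr Quaternion; rewrite /=; ring. Qed.

Lemma mulquatDr : right_distributive mul_quat add_quat.
Proof. by move=> x y z; congr Quaternion; rewrite /=; ring. Qed.

Lemma quat1_neq0 : quat1 != quat0.
Proof. by apply/eqP => -[] /eqP; rewrite oner_eq0. Qed.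

HB.instance Definition _ := GRing.Zmodule_isNzRing.Build (quaternion R)
  mulquatA mul1quat mulquat1 mulquatDl mulquatDr quat1_neq0.

Definition normsq_quat x : R := q0 x ^+ 2 + q1 x ^+ 2 + q2 x ^+ 2 + q3 x ^+ 2.

Definition inv_quat x := Quaternion
  (q0 x / normsq_quat x) (- (q1 x / normsq_quat x))
  (- (q2 x / normsq_quat x)) (- (q3 x / normsq_quat x)).

Lemma normsq_quat_eq0 x : (normsq_quat x == 0) = (x == 0).
Proof.
apply/eqP/eqP => [|->]; last by rewrite /normsq_quat /= expr0n /= !addr0.
case: x => a b c d; rewrite /normsq_quat /= => h.
have [a0 b0 c0 d0] : [/\ a = 0, b = 0, c = 0 & d = 0].
  by split; apply/eqP; rewrite -sqrf_eq0; apply/eqP;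
     have := sqr_ge0 a; have := sqr_ge0 b;
     have := sqr_ge0 c; have := sqr_ge0 d; lra.
by rewrite a0 b0 c0 d0.
Qed.

Let nonzero_quat : pred (quaternion R) := fun x => x != 0.

Lemma mulVquat : {in nonzero_quat, left_inverse 1 inv_quat *%R}.
Proof.
move=> x; rewrite -topredE /= /nonzero_quat -normsq_quat_eq0 => x0.
by congr Quaternion; rewrite /=; move: x0; rewrite /normsq_quat => x0; field.
Qed.

Lemma mulquatV : {in nonzero_quat, right_inverse 1 inv_quat *%R}.
Proof.
move=> x; rewrite -topredE /= /nonzero_quat -normsq_quat_eq0 => x0.
by congr Quaternion; rewrite /=; move: x0; rewrite /normsq_quat => x0; field.
Qed.

Lemma unit_quatP x y : y * x = 1 /\ x * y = 1 -> nonzero_quat x.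
Proof.
case=> yx1 _; apply/eqP => x0; move: yx1; rewrite x0 mulr0 => /esym/eqP.
by rewrite oner_eq0.
Qed.

Lemma inv_quat_out : {in [predC nonzero_quat], inv_quat =1 id}.
Proof.
move=> x; rewrite inE -topredE /= /nonzero_quat negbK => /eqP ->.
by rewrite /inv_quat /= !mul0r oppr0.
Qed.

HB.instance Definition _ := GRing.NzRing_hasMulInverse.Build (quaternion R)
  mulVquat mulquatV unit_quatP inv_quat_out.

Lemma unit_quatE x : (x \is a GRing.unit) = (x != 0).
Proof. by []. Qed.

End QuaternionRing.

Definition modulus (R : rcfType) (x : quaternion R) : R :=
  Num.sqrt (q0 x ^+ 2 + q1 x ^+ 2 + q2 x ^+ 2 + q3 x ^+ 2).

Section LeftEigenvalues.
Variables (R : realType) (n : nat).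
Implicit Types (A : 'M[quaternion R]_n) (i : 'I_n) (gamma : R).

(* The scaling [lambda *: x] multiplies each entry of [x] by [lambda] on the
   left. *)
Definition left_eigenvalue A (lambda : quaternion R) : Prop :=
  exists2 x : 'cV[quaternion R]_n, x != 0 & A *m x = lambda *: x.

Definition left_spectrum A : set (quaternion R) :=
  [set lambda | left_eigenvalue A lambda].

Definition deleted_row_sum A i : R := \sum_(j < n | j != i) modulus (A i j).

Definition deleted_col_sum A i : R := \sum_(j < n | j != i) modulus (A j i).

(* [powR] satisfies 0 `^ 0 = 1 and 0 `^ a = 0 for a != 0. *)
Definition ostrowski_ball gamma A i : set (quaternion R) :=
  [set z | modulus (z - A i i) <=
    deleted_row_sum A i `^ gamma * deleted_col_sum A i `^ (1 - gamma)].

End LeftEigenvalues.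

(* Main.v *)
Require Import Defs.
From mathcomp Require Import all_boot all_order all_algebra.
From mathcomp Require Import all_classical all_reals.
From mathcomp Require Import exp ring.

Local Open Scope classical_set_scope.
Local Open Scope ring_scope.

Import Order.TTheory GRing.Theory Num.Theory.

(** The moduli t_i = |x_i| of an eigenvector x for the eigenvalue lambda satisfy
    |lambda - a_ii| t_i <= sum_(j != i) |a_ij| t_j, because the quaternionic
    modulus is multiplicative and satisfies the triangle inequality
    ([left_eigenvector_row_le]); from here on the problem only concerns
    nonnegative real numbers ([ostrowski_dominated_row]).

    For gamma = 1, a row i where t_i is maximal works, as for Gershgorin discs.
    For gamma < 1, put y_i = t_i `^ (1 - gamma)^-1.  Hoelder's inequality bounds
    sum_(j != i) |a_ij| t_j by r_i `^ gamma * Y_i `^ (1 - gamma), where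
    Y_i = sum_(j != i) |a_ij| y_j.  Summed over i, the Y_i and the c_i y_i have
    the same total, by exchanging the two summations, so some row i with
    y_i > 0 has Y_i <= c_i y_i ([exists_row_le_col]).  For this row
    |lambda - a_ii| t_i <= r_i `^ gamma * c_i `^ (1 - gamma) * t_i, and t_i
    cancels. *)

(** * The modulus of a quaternion *)

Section Modulus.
Variable R : rcfType.
Implicit Types x y : quaternion R.

Lemma modulusE x : modulus x = Num.sqrt (normsq_quat x).
Proof. by []. Qed.

Lemma normsq_quat_ge0 x : 0 <= normsq_quat x.
Proof. by rewrite !addr_ge0 ?sqr_ge0. Qed.

Lemma modulus_ge0 x : 0 <= modulus x.
Proof. exact: sqrtr_ge0. Qed.

Lemma sqr_modulus x : modulus x ^+ 2 = normsq_quat x.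
Proof. by rewrite modulusE sqr_sqrtr ?normsq_quat_ge0. Qed.

Lemma modulus_eq0 x : (modulus x == 0) = (x == 0).
Proof. by rewrite -sqrf_eq0 sqr_modulus normsq_quat_eq0. Qed.

Lemma modulus0 : modulus (0 : quaternion R) = 0.
Proof. by apply/eqP; rewrite modulus_eq0. Qed.

(** Euler's four-square identity. *)
Lemma modulusM x y : modulus (x * y) = modulus x * modulus y.
Proof.
rewrite !modulusE -sqrtrM ?normsq_quat_ge0//; congr Num.sqrt.
by rewrite /normsq_quat /=; ring.
Qed.

(** The inner product of x and y is the real part of conj(x) * y, whence the
    Cauchy-Schwarz inequality needed here. *)
Lemma ler_modulusD x y : modulus (x + y) <= modulus x + modulus y.
Proof.
pose xy := q0 x * q0 y + q1 x * q1 y + q2 x * q2 y + q3 x * q3 y.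
have le_xy : xy <= modulus x * modulus y.
  rewrite (le_trans (ler_norm _))// -ler_sqr ?nnegrE ?mulr_ge0 ?modulus_ge0//.
  rewrite real_normK ?num_real// exprMn !sqr_modulus -subr_ge0.
  pose z := Quaternion (q0 x) (- q1 x) (- q2 x) (- q3 x) * y.
  rewrite (_ : _ - _ = q1 z ^+ 2 + q2 z ^+ 2 + q3 z ^+ 2).
    by rewrite !addr_ge0 ?sqr_ge0.
  by rewrite /xy /normsq_quat /=; ring.
rewrite -ler_sqr ?nnegrE ?addr_ge0 ?modulus_ge0// sqrrD !sqr_modulus.
rewrite (_ : normsq_quat (x + y) = normsq_quat x + xy *+ 2 + normsq_quat y).
  by rewrite lerD2r lerD2l lerMn2r.
by rewrite /xy /normsq_quat /=; ring.
Qed.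

Lemma ler_modulus_sum (I : Type) (r : seq I) (P : pred I)
    (F : I -> quaternion R) :
  modulus (\sum_(i <- r | P i) F i) <= \sum_(i <- r | P i) modulus (F i).
Proof.
elim/big_ind2: _ => [|x a y b xa yb|//]; first by rewrite modulus0.
by rewrite (le_trans (ler_modulusD _ _)) ?lerD.
Qed.

End Modulus.

(** * Hoelder's inequality for finite sums *)

(** Young's inequality, with the exponents 1 / gamma and 1 / (1 - gamma). *)
Lemma weighted_am_gm (R : realType) (gamma u v : R) :
  0 < gamma < 1 -> 0 <= u -> 0 <= v ->
  u `^ gamma * v `^ (1 - gamma) <= gamma * u + (1 - gamma) * v.
Proof.
move=> /andP[g0 g1] u0 v0; have h0 : 0 < 1 - gamma by rewrite subr_gt0.
have := @conjugate_powR R (u `^ gamma) (v `^ (1 - gamma)) gamma^-1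
  (1 - gamma)^-1 (powR_ge0 _ _) (powR_ge0 _ _).
rewrite !invr_gt0 !invrK -!powRrM !mulfV ?gt_eqF// !powRr1// => young.
by rewrite [gamma * u]mulrC [_ * v]mulrC young// subrKC.
Qed.

(** Normalising both families to total 1 reduces the claim to the weighted
    arithmetic-geometric mean inequality. *)
Lemma hoelder_sum (R : realType) (I : finType) (P : pred I) (gamma : R)
    (u v : I -> R) :
  0 <= gamma <= 1 -> (forall i, 0 <= u i) -> (forall i, 0 <= v i) ->
  \sum_(i | P i) u i `^ gamma * v i `^ (1 - gamma) <=
  (\sum_(i | P i) u i) `^ gamma * (\sum_(i | P i) v i) `^ (1 - gamma).
Proof.
move=> /andP[]; rewrite le_eqVlt => /predU1P[<- _ u0 v0|g0].
  rewrite subr0 powRr0 mul1r powRr1 ?sumr_ge0//.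
  by apply: ler_sum => i _; rewrite powRr0 mul1r powRr1.
rewrite le_eqVlt => /predU1P[-> u0 v0|g1 u0 v0].
  rewrite subrr powRr0 mulr1 powRr1 ?sumr_ge0//.
  by apply: ler_sum => i _; rewrite powRr0 mulr1 powRr1.
have h0 : 0 < 1 - gamma by rewrite subr_gt0.
set U := \sum_(i | P i) u i; set V := \sum_(i | P i) v i.
have U0 : 0 <= U by exact: sumr_ge0.
have V0 : 0 <= V by exact: sumr_ge0.
have RHS0 : 0 <= U `^ gamma * V `^ (1 - gamma) by rewrite mulr_ge0 ?powR_ge0.
(* If a total vanishes, so do the terms on the left: since 0 `^ 0 = 1, this
   holds only for gamma different from 0 and 1. *)
have [/psumr_eq0P z|Un0] := eqVneq U 0.
  by rewrite big1// => i Pi; rewrite z// powR0 ?gt_eqF// mul0r.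
have [/psumr_eq0P z|Vn0] := eqVneq V 0.
  by rewrite big1// => i Pi; rewrite z// (powR0 (x := 1 - _)) ?gt_eqF// mulr0.
have term i : u i `^ gamma * v i `^ (1 - gamma) <=
    U `^ gamma * V `^ (1 - gamma) *
    (gamma * (u i / U) + (1 - gamma) * (v i / V)).
  rewrite -{1}[u i](divfK Un0) -{1}[v i](divfK Vn0).
  rewrite (@powRM _ (u i / U)) ?(@powRM _ (v i / V)) ?divr_ge0//.
  rewrite mulrACA [leLHS]mulrC; apply: ler_wpM2l => //.
  by apply: weighted_am_gm; rewrite ?g0 ?divr_ge0.
apply: le_trans; first by apply: ler_sum => i _; exact: term.
rewrite -mulr_sumr big_split/= -!mulr_sumr -!mulr_suml !divff//.
by rewrite !mulr1 subrKC mulr1.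
Qed.

(** * Nonnegative systems dominated by their off-diagonal part *)

Section DominatedRows.
Variables (R : realType) (I : finType) (b : I -> I -> R).
Hypothesis b_ge0 : forall i j, 0 <= b i j.

(** Both sides have the same sum over i, by exchanging the two summations.  If
    the inequality failed in every row with y_i > 0, then the left-hand sides
    would have the larger sum, since in the rows with y_i = 0 the right-hand
    side vanishes. *)
Lemma exists_row_le_col (y : I -> R) :
  (forall i, 0 <= y i) -> (exists i, 0 < y i) ->
  exists2 i, 0 < y i &
    \sum_(j | j != i) b i j * y j <= (\sum_(j | j != i) b j i) * y i.
Proof.
move=> y0 [k yk]; apply/exists2P/not_existsP => noi.
have gt i : 0 < y i ->
    (\sum_(j | j != i) b j i) * y i < \sum_(j | j != i) b i j * y j.
  by move=> yi; rewrite ltNge; apply/negP => le; apply: (noi i).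
have ge i : (\sum_(j | j != i) b j i) * y i <= \sum_(j | j != i) b i j * y j.
  have [yi|] := ltP 0 (y i); first exact/ltW/gt.
  rewrite le_eqVlt ltNge y0 orbF => /eqP ->.
  by rewrite mulr0 sumr_ge0// => j _; rewrite mulr_ge0.
have: \sum_i (\sum_(j | j != i) b j i) * y i <
      \sum_i \sum_(j | j != i) b i j * y j.
  rewrite (bigD1 k)//= [ltRHS](bigD1 k)//= ltr_leD ?gt//.
  by apply: ler_sum => i _; exact: ge.
under eq_bigr do rewrite mulr_suml.
rewrite (exchange_big_dep xpredT)//=.
under eq_bigr do under eq_bigl do rewrite eq_sym.
by rewrite ltxx.
Qed.

(** A nonzero nonnegative vector t dominated by its off-diagonal part forces
    some diagonal entry below its Ostrowski radius: Hoelder's inequality spends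
    the exponent gamma on the row sum, and [exists_row_le_col] turns what is
    left into the column sum. *)
Lemma ostrowski_dominated_row (gamma : R) (t : I -> R) :
  0 <= gamma <= 1 ->
  (forall i, 0 <= t i) -> (exists i, 0 < t i) ->
  (forall i, b i i * t i <= \sum_(j | j != i) b i j * t j) ->
  exists i, b i i <= (\sum_(j | j != i) b i j) `^ gamma *
                     (\sum_(j | j != i) b j i) `^ (1 - gamma).
Proof.
move=> g01 t0 [k tk] dom; have := g01 => /andP[_].
rewrite le_eqVlt => /predU1P[->|g1].
  (* The exponent (1 - gamma)^-1 used below is unavailable here; only the row
     sum occurs in the bound, and the largest entry of t decides. *)
  pose i := [arg max_(j > k) t j]%O.
  have tmax j : t j <= t i by rewrite /i; case: arg_maxP => // l _; apply.
  have ti : 0 < t i by exact: lt_le_trans tk (tmax k).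
  exists i; rewrite subrr powRr0 mulr1 powRr1 ?sumr_ge0//.
  rewrite -(ler_pM2r ti) (le_trans (dom i))// mulr_suml.
  by apply: ler_sum => j _; rewrite ler_wpM2l.
have h0 : 0 < 1 - gamma by rewrite subr_gt0.
pose y i := t i `^ (1 - gamma)^-1.
have yK i : y i `^ (1 - gamma) = t i.
  by rewrite /y -powRrM mulVf ?gt_eqF// powRr1.
have y0 i : 0 <= y i by exact: powR_ge0.
have [i yi Yi] : exists2 i, 0 < y i &
    \sum_(j | j != i) b i j * y j <= (\sum_(j | j != i) b j i) * y i.
  by apply: exists_row_le_col => //; exists k; exact: powR_gt0.
have ti : 0 < t i by rewrite -yK powR_gt0.
exists i; rewrite -(ler_pM2r ti) (le_trans (dom i))//.
have split j : b i j * t j = b i j `^ gamma * (b i j * y j) `^ (1 - gamma).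
  by rewrite powRM// yK mulrA -powRD subrKC ?powRr1// oner_eq0.
under eq_bigr do rewrite split.
apply: le_trans; first by apply: hoelder_sum => // j; rewrite mulr_ge0.
rewrite -mulrA ler_wpM2l ?powR_ge0// -(yK i) -powRM ?sumr_ge0//.
by rewrite ge0_ler_powR ?nnegrE ?(ltW h0)// ?mulr_ge0 ?sumr_ge0// => j _;
  rewrite mulr_ge0.
Qed.

End DominatedRows.

(** * Localisation of the left eigenvalues *)

Lemma left_eigenvector_row_le (R : realType) (n : nat) (A : 'M[quaternion R]_n)
    (lambda : quaternion R) (x : 'cV[quaternion R]_n) (i : 'I_n) :
  A *m x = lambda *: x ->
  modulus (lambda - A i i) * modulus (x i 0) <=
  \sum_(j < n | j != i) modulus (A i j) * modulus (x j 0).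
Proof.
move=> /matrixP/(_ i 0); rewrite !mxE (bigD1 i)//= => Ax.
rewrite -modulusM mulrBl -Ax [A i i * _ + _]addrC addrK.
apply: le_trans (ler_modulus_sum _ _ _ _ _) _.
by apply: ler_sum => j _; rewrite modulusM.
Qed.

Theorem theorem3p3 (R : realType) (n : nat) (A : 'M[quaternion R]_n)
    (gamma : R) (hgamma : 0 <= gamma <= 1) :
  left_spectrum A `<=` \bigcup_(i in [set: 'I_n]) ostrowski_ball gamma A i.
Proof.
move=> lambda [x x0 Ax].
(* The comparison matrix: the moduli of A off the diagonal, and those of
   lambda - A on it. *)
pose b i j := modulus (if j == i then lambda - A i i else A i j).
have boff i j : j != i -> b i j = modulus (A i j) by rewrite /b => /negPf ->.
have [i] : exists i, b i i <= (\sum_(j | j != i) b i j) `^ gamma *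
                              (\sum_(j | j != i) b j i) `^ (1 - gamma).
  apply: (ostrowski_dominated_row _ _ _ _ _ (fun i => modulus (x i 0))) => //.
  - by move=> i j; exact: modulus_ge0.
  - by move=> i; exact: modulus_ge0.
  - have [i xi] : exists i, x i 0 != 0.
      apply: contra_notP (elimN eqP x0) => /forallNP z.
      by apply/colP => i; rewrite mxE; apply/eqP/negPn/negP/z.
    by exists i; rewrite lt_def modulus_eq0 xi modulus_ge0.
  - move=> i; rewrite /b eqxx.
    apply: le_trans (left_eigenvector_row_le _ _ _ _ _ i Ax) _.
    by apply: ler_sum => j /negPf ->.
rewrite {1}/b eqxx => bi; exists i => //=.
rewrite /ostrowski_ball /=; congr (_ <= _ `^ _ * _ `^ _): bi.
  by apply: eq_bigr => j; exact: boff.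
by apply: eq_bigr => j ji; rewrite boff// eq_sym.
Qed.
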